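(* Let $n\ge 4$ and let $G_3: x\mapsto x^7$ over $\mathbb{F}_{2^n}$. Then its differential spectrum is given by (all $\omega_i$ not listed being $0$): - if $n$ is odd, $$\omega_6=\frac{2^{n-2}+1}{6}-\frac{K(1)}{8},\quad \omega_4=0,\quad \omega_2=2^{n-1}-3\omega_6,\quad \omega_0=2^{n-1}+2\omega_6;$$ - if $n$ is even, $$\omega_6=\frac{2^{n-2}-4}{6}+\frac{K(1)}{8},\quad \omega_4=1,\quad \omega_2=2^{n-1}-3\omega_6-2,\quad \omega_0=2^{n-1}+2\omega_6+1.$$ In particular, $G_3$ is differentially $6$-uniform for all $n\ge 6$.
   Context: For $b\in\mathbb{F}_{2^n}$, $\delta(b)=\#\{x\in\mathbb{F}_{2^n} : (x+1)^7+x^7=b\}$. The differential spectrum is the family $\omega_i=\#\{b\in\mathbb{F}_{2^n} : \delta(b)=i\}$. The differential uniformity of a power function is $\max_{b\in\mathbb{F}_{2^n}}\delta(b)$; the function is differentially $k$-uniform if this maximum equals $k$. $K(1)$ is the Kloosterman sum $K(1)=\sum_{x\in\mathbb{F}_{2^n}}(-1)^{Tr(x^{-1}+x)}$, where $Tr$ is the absolute trace $\mathbb{F}_{2^n}\to\mathbb{F}_2$ and $x^{-1}$ is taken to be $0$ for $x=0$ (so the term $x=0$ contributes $1$). *)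

(* Defs.v *)
From mathcomp Require Import all_boot all_order all_algebra all_field.

Set Implicit Arguments.
Unset Strict Implicit.
Unset Printing Implicit Defensive.

Import GRing.Theory.
Local Open Scope ring_scope.

(* The field with 2 ^ n elements is any F : finFieldType with #|F| = 2 ^ n. *)

Section PowerMaps.

Variables (F : finFieldType) (d : nat).

(* The shift is by 1 only: for a power map this determines all the other
   derivatives. *)
Definition delta (b : F) : nat :=
  #|[set x : F | (x + 1) ^+ d + x ^+ d == b]|.

Definition omega (i : nat) : nat := #|[set b : F | delta b == i]|.

Definition differential_uniformity : nat := (\max_(b : F) delta b)%N.

End PowerMaps.

(* The absolute trace from F to its prime field, kept as an element of F;
   meaningful for #|F| = 2 ^ n. *)
Definition abs_trace (F : finFieldType) (n : nat) (x : F) : F :=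
  \sum_(i < n) x ^+ (2 ^ i).

Lemma abs_trace01 (F : finFieldType) (n : nat) (x : F) :
  #|F| = (2 ^ n)%N -> abs_trace n x = 0 \/ abs_trace n x = 1.
Proof.
move=> cardF.
have ch2 : 2 \in [pchar F] by exact: card_finPcharP cardF _.
have n_gt0 : (0 < n)%N.
  by case: n cardF (finNzRing_gt1 F) => // ->.
have sq : abs_trace n x ^+ 2 = abs_trace n x.
  rewrite -(pFrobenius_autE ch2) rmorph_sum /=.
  case: n n_gt0 cardF => // m _ cardF.
  rewrite /abs_trace big_ord_recr big_ord_recl /= addrC expn0 expr1.
  congr (_ + _); last first.
    by apply: eq_bigr => i _; rewrite pFrobenius_autE -exprM -expnSr.
  by rewrite pFrobenius_autE -exprM -expnSr -cardF expf_card.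
have /eqP : abs_trace n x * (abs_trace n x - 1) = 0.
  by rewrite mulrBr mulr1 -expr2 sq subrr.
by rewrite mulf_eq0 subr_eq0 => /orP[] /eqP; [left|right].
Qed.

(* Since abs_trace is 0 or 1, the boolean exponent, read in nat, is the trace.
   The term x = 0 contributes 1, because 0^-1 = 0. *)
Definition kloosterman1 (F : finFieldType) (n : nat) : int :=
  \sum_(x : F) (-1) ^+ (abs_trace n (x^-1 + x) != 0).

(* Main.v *)
Require Import Defs.
From mathcomp Require Import all_boot all_order all_algebra all_field.
From mathcomp Require Import ring lra zify.

(** With [u = x^2 + x] one has [(x+1)^7 + x^7 = u^3 + u + 1], and [x |-> x^2 + x]
    is two-to-one onto the elements of trace [0].  So [delta b] is
    twice the number [r b] of trace-zero roots of [u^3 + u + 1 = b].  The sum of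
    two distinct trace-zero roots is the third root, whence [r b <= 3], and
    [r b = 2] only for [b = 1] and [n] even.  The spectrum then follows from the
    first two moments of [r]; the second one counts the trace-zero points of the
    conic [u^2 + uv + v^2 = 1], on which [K(1)] appears.

    [omega 6 != 0] for [n >= 7] needs only a weak bound on [K(1)], which follows
    from the fourth moment of the sums [K(a)]: [K(a)^2] is the Fourier transform of
    [H(s) = sum_x chi(1/x + 1/(x+s))], and [H(s)] is itself [K(1/s)] up to simple
    terms, so Parseval evaluates [sum_a (K(a)^2 - 2^n)^2] exactly.  This does not
    suffice for [n = 6]; there the roots of [u^3 + u + 1] lie in the subfield with
    8 elements, so they have trace zero. *)

Set Implicit Arguments.
Unset Strict Implicit.
Unset Printing Implicit Defensive.

Import GRing.Theory Num.Theory.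
Local Open Scope ring_scope.

(** * The absolute trace and its additive character *)

Section AdditiveCharacter.

Variables (n : nat) (F : finFieldType).
Hypothesis hF : #|F| = (2 ^ n)%N.

Lemma pchar2 : 2 \in [pchar F].
Proof. exact: card_finPcharP hF _. Qed.

Lemma exponent_gt0 : (0 < n)%N.
Proof. by case: n hF (finNzRing_gt1 F) => // ->. Qed.

(** [ring] does not know that 2 = 0. In the uses below, [z] is half the difference of the two sides
    expanded over the integers. *)
Lemma eq_mod2 (x y z : F) : x = y + (z + z) -> x = y.
Proof. by rewrite (addrr_pchar2 pchar2) addr0. Qed.

Lemma addr_eq0_pchar2 (x y : F) : (x + y == 0) = (x == y).
Proof. by rewrite addr_eq0 (oppr_pchar2 pchar2). Qed.

Lemma natr_cardset (P : pred F) : (#|[set x | P x]|)%:R = \sum_x (P x)%:R :> int.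
Proof.
rewrite -sum1_card natr_sum big_mkcond /=; apply: eq_bigr => x _.
by rewrite inE; case: (P x).
Qed.

Lemma abs_traceD (x y : F) :
  abs_trace n (x + y) = abs_trace n x + abs_trace n y.
Proof.
rewrite /abs_trace -big_split /=; apply: eq_bigr => i _.
rewrite exprDn_pchar //; apply/pnatP; rewrite ?expn_gt0 // => p pp.
by rewrite Euclid_dvdX // => /andP[]; rewrite dvdn_prime2 // => /eqP -> _; exact: pchar2.
Qed.

Lemma abs_trace_sqr (x : F) : abs_trace n (x ^+ 2) = abs_trace n x.
Proof.
transitivity (abs_trace n x ^+ 2); last first.
  by case: (abs_trace01 x hF) => ->; rewrite ?expr0n ?expr1n.
rewrite -[RHS](pFrobenius_autE pchar2) rmorph_sum /=; apply: eq_bigr => i _.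
by rewrite pFrobenius_autE -!exprM mulnC.
Qed.

(** The trace is a nonzero polynomial of degree [2 ^ n.-1], too small to vanish at all [2 ^ n]
    elements. *)
Lemma abs_trace_surj : exists c : F, abs_trace n c = 1.
Proof.
have [/existsP[c /eqP h]|/existsPn h] := boolP [exists c : F, abs_trace n c == 1].
  by exists c.
have h0 (c : F) : abs_trace n c = 0.
  by case: (abs_trace01 c hF) => // e; move: (h c); rewrite e eqxx.
pose p : {poly F} := \sum_(i < n) 'X^(2 ^ i).
have pE c : p.[c] = 0.
  by rewrite -(h0 c) horner_sum; apply: eq_bigr => i _; rewrite hornerXn.
have sp : (size p <= (2 ^ n.-1).+1)%N.
  apply: (leq_trans (size_sum _ _ _)); apply/bigmax_leqP => i _.
  by rewrite size_polyXn ltnS leq_exp2l // -ltnS prednK ?exponent_gt0.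
have p0 : p != 0.
  apply/eqP => /(congr1 (fun q : {poly F} => q`_(2 ^ n.-1))).
  have ltn1 : (n.-1 < n)%N by rewrite prednK ?exponent_gt0.
  rewrite coef0 coef_sum (bigD1 (Ordinal ltn1)) //= coefXn eqxx big1 ?addr0 => [/eqP|i ne].
    by rewrite oner_eq0.
  rewrite coefXn eqn_exp2l // eq_sym; case: eqP => // e; case/eqP: ne; exact: val_inj.
have := max_poly_roots p0 (rs := enum F).
rewrite enum_uniq -cardE hF => /(_ _ isT) H.
have := leq_trans (H _) sp; rewrite ltnS leq_exp2l // leqNgt prednK ?exponent_gt0 // leqnn => H'.
by suff: false by []; apply: H'; apply/allP => c _; apply/eqP/pE.
Qed.

Definition trace_char (x : F) : int := (-1) ^+ (abs_trace n x != 0).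

Local Notation chi := trace_char.

Lemma chiE (x : F) : chi x = 2 * (abs_trace n x == 0)%:R - 1.
Proof. by rewrite /trace_char; case: (_ == _). Qed.

Lemma chi0 : chi 0 = 1.
Proof.
rewrite /trace_char /abs_trace big1 ?eqxx // => i _; by rewrite expr0n expn_eq0.
Qed.

Lemma chi1 : chi 1 = (-1) ^+ odd n.
Proof.
rewrite /trace_char /abs_trace (eq_bigr (fun=> 1)) => [|i _]; last by rewrite expr1n.
rewrite sumr_const card_ord -(dvdn_pcharf pchar2) dvdn2 negbK.
by [].
Qed.

Lemma chiD (x y : F) : chi (x + y) = chi x * chi y.
Proof.
rewrite /trace_char abs_traceD.
by case: (abs_trace01 x hF) (abs_trace01 y hF) => -> [] ->;
  rewrite ?addr0 ?add0r ?(addrr_pchar2 pchar2) ?eqxx ?oner_eq0.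
Qed.

Lemma chi_sqr (x : F) : chi (x ^+ 2) = chi x.
Proof. by rewrite /trace_char abs_trace_sqr. Qed.

Lemma chiM (x : F) : chi x * chi x = 1.
Proof. by rewrite -chiD (addrr_pchar2 pchar2) chi0. Qed.

Lemma sum_chi : \sum_(x : F) chi x = 0.
Proof.
have [c c1] := abs_trace_surj.
have : \sum_(x : F) chi x = - \sum_(x : F) chi x.
  rewrite {1}(reindex_inj (addrI c)) -sumrN; apply: eq_bigr => x _.
  by rewrite chiD /trace_char c1 oner_eq0 mulN1r.
lia.
Qed.

Lemma sum_chiM (c : F) : \sum_(x : F) chi (c * x) = (2 ^ n * (c == 0))%:R.
Proof.
have [->|c0] := eqVneq c 0.
  rewrite (eq_bigr (fun=> 1)) => [|x _]; last by rewrite mul0r chi0.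
  by rewrite sumr_const -hF muln1.
by rewrite muln0 -[RHS]sum_chi [RHS](reindex_inj (mulfI c0)).
Qed.

(** A nonempty fibre forces [chi u = 1] and lies in some [[set t; t + 1]], so the left side is at
    most the right. Summed over [u] both give [2 ^ n], hence they agree termwise. *)
Lemma artin_schreier_count (u : F) :
  \sum_x (x ^+ 2 + x == u)%:R = 1 + chi u.
Proof.
pose N (v : F) : int := \sum_(x : F) (x ^+ 2 + x == v)%:R.
have le v : N v <= 1 + chi v.
  rewrite /N -natr_cardset; have [e0|[t]] := set_0Vmem [set x | x ^+ 2 + x == v].
    by rewrite e0 cards0 /trace_char; case: (_ != _).
  rewrite inE => /eqP tv.
  have -> : chi v = 1 by rewrite -tv chiD chi_sqr chiM.
  rewrite (_ : 1 + 1 = 2%:R) // ler_nat.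
  apply: (leq_trans (subset_leq_card (B := [set t; t + 1]) _)); last first.
    by rewrite cards2; case: (_ != _).
  apply/subsetP => x; rewrite !inE -tv => /eqP e.
  have : (x + t) * (x + (t + 1)) = 0.
    transitivity ((x ^+ 2 + x) + (t ^+ 2 + t) + (x * t + x * t)); first by ring.
    by rewrite e !(addrr_pchar2 pchar2).
  by move/eqP; rewrite mulf_eq0 !addr_eq0_pchar2.
have S0 : \sum_v (1 + chi v - N v) = 0.
  rewrite sumrB big_split /= sum_chi addr0 /N exchange_big /=.
  rewrite [X in _ - X](eq_bigr (fun=> 1)) ?subrr // => x _.
  rewrite (bigD1 (x ^+ 2 + x)) //= eqxx big1 ?addr0 // => v.
  by rewrite eq_sym => /negbTE ->.
move/(psumr_eq0P _): S0 => /(_ _ u isT) H.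
by apply/esym/eqP; rewrite -subr_eq0 H // => v _; rewrite subr_ge0.
Qed.

Lemma quadratic_count (y c : F) : y != 0 ->
  \sum_z (z ^+ 2 + y * z == c)%:R = 1 + chi (c / y ^+ 2).
Proof.
move=> y0; rewrite -artin_schreier_count (reindex_inj (mulfI y0)) /=.
apply: eq_bigr => t _; congr (nat_of_bool _)%:R.
rewrite -[RHS](inj_eq (mulIf (expf_neq0 2 y0))) divfK ?expf_neq0 //.
by congr (_ == _); ring.
Qed.

End AdditiveCharacter.

(** * Trace-zero roots of the cubic and their moments *)

Section CubicRoots.

Variables (n : nat) (F : finFieldType).
Hypothesis hF : #|F| = (2 ^ n)%N.

Local Notation chi := (trace_char n).
Local Notation K := (kloosterman1 F n).

Lemma sum_indicator (u : F) (f : F -> int) : \sum_v (u == v)%:R * f v = f u.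
Proof.
rewrite (bigD1 u) //= eqxx mul1r big1 ?addr0 // => v.
by rewrite eq_sym => /negbTE ->; rewrite mul0r.
Qed.

Definition trace0_roots (b : F) : {set F} :=
  [set u | (abs_trace n u == 0) && (u ^+ 3 + u + 1 == b)].

Lemma derivative_pow7 (x : F) :
  (x + 1) ^+ 7 + x ^+ 7 = (x ^+ 2 + x) ^+ 3 + (x ^+ 2 + x) + 1.
Proof.
pose z := x ^+ 7 + 3 * x ^+ 6 + 9 * x ^+ 5 + 16 * x ^+ 4 + 17 * x ^+ 3
  + 10 * x ^+ 2 + 3 * x.
by apply: (eq_mod2 hF (z := z)); rewrite /z; ring.
Qed.

Lemma delta_pow7 (b : F) : delta 7 b = (2 * #|trace0_roots b|)%N.
Proof.
apply/eqP; rewrite -(eqr_nat int) natrM; apply/eqP.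
rewrite /delta /trace0_roots !natr_cardset mulr_sumr.
transitivity (\sum_(x : F) \sum_u
    (x ^+ 2 + x == u)%:R * (u ^+ 3 + u + 1 == b)%:R : int).
  by apply: eq_bigr => x _; rewrite sum_indicator derivative_pow7.
rewrite exchange_big /=; apply: eq_bigr => u _.
rewrite -mulr_suml (artin_schreier_count hF) chiE.
by case: (_ == 0); case: (_ == b).
Qed.

(** In characteristic 2 the two values differ by [(u + v) * (u ^+ 2 + u * v + v ^+ 2 + 1)]. *)
Lemma cubic_eq (u v : F) :
  (u ^+ 3 + u + 1 == v ^+ 3 + v + 1) = (u == v) || (u ^+ 2 + u * v + v ^+ 2 == 1).
Proof.
rewrite -(addr_eq0_pchar2 hF (_ + 1)) -(addr_eq0_pchar2 hF u v).
rewrite -(addr_eq0_pchar2 hF (_ + _) 1) -mulf_eq0; congr (_ == 0).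
pose z := 1 - u ^+ 2 * v - u * v ^+ 2.
by apply: (eq_mod2 hF (z := z)); rewrite /z; ring.
Qed.

(** The cubic has no square term, so its three roots sum to zero; the trace is additive. *)
Lemma trace0_roots_conj (b u v : F) : u \in trace0_roots b -> v \in trace0_roots b ->
  u != v -> u + v \in trace0_roots b.
Proof.
rewrite !inE => /andP[/eqP tu /eqP <-] /andP[/eqP tv]; rewrite eq_sym.
rewrite (abs_traceD hF) tu tv addr0 eqxx /= !cubic_eq => /orP[->//|q] _.
rewrite [X in _ || X](_ : _ = true) ?orbT // -(eqP q).
by apply/eqP/(eq_mod2 hF (z := u ^+ 2 + u * v)); ring.
Qed.

Lemma trace0_roots_sub (b u v : F) : u \in trace0_roots b -> v \in trace0_roots b ->
  u != v -> trace0_roots b \subset [set u; v; u + v].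
Proof.
rewrite !inE => /andP[_ /eqP <-] /andP[_ ev] uv.
apply/subsetP => w; rewrite !inE => /andP[_]; rewrite cubic_eq.
move: ev; rewrite cubic_eq eq_sym (negbTE uv) /= => /eqP q1 /orP[->//|/eqP q2].
(* Both [(w, u)] and [(v, u)] lie on the conic; the sum of the two equations factors. *)
have : (w + v) * (w + (u + v)) = 0.
  transitivity ((w ^+ 2 + w * u + u ^+ 2) + (v ^+ 2 + v * u + u ^+ 2)
                + (w * v - u ^+ 2 + (w * v - u ^+ 2)) ); first by ring.
  by rewrite q1 q2 !(addrr_pchar2 (pchar2 hF)).
move/eqP; rewrite mulf_eq0 !(addr_eq0_pchar2 hF) => /orP[->|->]; by rewrite ?orbT.
Qed.

Lemma card_trace0_roots_le3 (b : F) : (#|trace0_roots b| <= 3)%N.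
Proof.
have [//|/card_gt1P[u [v [ub vb uv]]]] := leqP #|trace0_roots b| 1.
  by move/leq_trans; apply.
apply: leq_trans (subset_leq_card (trace0_roots_sub ub vb uv)) _.
rewrite -setUA !cardsU1 cards1; by case: (_ \notin _); case: (_ \notin _).
Qed.

(** Here the equation is [u * (u + 1) ^+ 2 = 0], and 1 has trace [n] mod 2. *)
Lemma trace0_roots1 : trace0_roots 1 = if odd n then [set 0] else [set 0; 1].
Proof.
apply/setP => u; have := cubic_eq u 0.
rewrite !expr0n mulr0 !addr0 add0r sqrf_eq1 (oppr_pchar2 (pchar2 hF)) orbb => e.
rewrite inE e.
have t0 : abs_trace n (0 : F) == 0 by move: (chi0 n F); rewrite /trace_char; case: (_ == _).
have t1 : (abs_trace n (1 : F) == 0) = ~~ odd n.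
  by move: (chi1 hF); rewrite /trace_char; case: (_ == 0); case: (odd n).
case: (odd n) t1 => t1; rewrite !inE.
  by have [->|_] := eqVneq u 0; [rewrite t0|have [->|_] := eqVneq u 1; rewrite ?t1 ?andbF].
by have [->|_] := eqVneq u 0; [rewrite t0|have [->|_] := eqVneq u 1; rewrite ?t1 ?andbF].
Qed.

(** If [u] and [v] are the only roots, then [u + v] is one of them, so 0 is a root and [b = 1]. *)
Lemma card_trace0_roots_eq2 (b : F) : (#|trace0_roots b| == 2) = (b == 1) && ~~ odd n.
Proof.
have [->|b1] := eqVneq b 1.
  rewrite trace0_roots1; case: (odd n); by rewrite ?cards1 // cards2 (eq_sym 0) oner_eq0.
apply/negbTE/negP => /cards2P[u [v [uv e]]].
have ub : u \in trace0_roots b by rewrite e !inE eqxx.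
have vb : v \in trace0_roots b by rewrite e !inE eqxx orbT.
have b0 : 0 \in trace0_roots b -> False.
  by rewrite inE expr0n /= !add0r (eq_sym 1) (negbTE b1) andbF.
have := trace0_roots_conj ub vb uv.
rewrite {1}e !inE -[X in _ == X]addr0 (inj_eq (addrI u)).
rewrite -[X in _ || (_ == X)]add0r (inj_eq (addIr v)).
by case/orP => /eqP z; apply: b0; rewrite -z.
Qed.

Lemma omega_pow7 (k : nat) : omega F 7 (2 * k) = #|[set b : F | #|trace0_roots b| == k]|.
Proof.
by apply: eq_card => b; rewrite !inE delta_pow7 eqn_pmul2l.
Qed.

Lemma omega_pow7_eq0 (i : nat) : i \notin [:: 0; 2; 4; 6]%N -> omega F 7 i = 0%N.
Proof.
move=> hi; apply/eqP; rewrite cards_eq0; apply/eqP/setP => b; rewrite !inE delta_pow7.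
apply: contraNF hi => /eqP <-.
by move: (card_trace0_roots_le3 b); case: #|_| => [|[|[|[|m]]]].
Qed.

Lemma omega4 : omega F 7 4 = ~~ odd n.
Proof.
rewrite (omega_pow7 2); under eq_finset => b do rewrite card_trace0_roots_eq2.
case: (odd n); last by rewrite /= -(cards1 (1 : F)); apply: eq_card => b; rewrite !inE andbT.
by apply/eqP; rewrite cards_eq0; apply/eqP/setP => b; rewrite !inE andbF.
Qed.

(** Taking [f k] to be 1, [k] and [k ^ 2] turns the moments into linear equations for the
    spectrum. *)
Lemma sum_card_trace0_roots (f : nat -> int) :
  \sum_(b : F) f #|trace0_roots b| =
  f 0%N * (omega F 7 0)%:R + f 1%N * (omega F 7 2)%:R
  + f 2%N * (omega F 7 4)%:R + f 3%N * (omega F 7 6)%:R.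
Proof.
rewrite (omega_pow7 0) (omega_pow7 1) (omega_pow7 2) (omega_pow7 3) !natr_cardset.
rewrite !mulr_sumr -!big_split /=; apply: eq_bigr => b _.
move: (card_trace0_roots_le3 b).
by case: #|_| => [|[|[|[|m]]]] //= _; rewrite !(mulr0, mulr1, addr0, add0r).
Qed.

Lemma quadric_fiber_count (u : F) :
  \sum_v (u ^+ 2 + u * v + v ^+ 2 == 1)%:R =
  1 + chi (1 : F) * chi u^-1 - chi (1 : F) * (0 == u)%:R.
Proof.
(* For [u = 0] only [v = 1] fits, while [0^-1 = 0] makes the generic formula [1 + chi 1]; the last
   term corrects this. *)
have [->|u0] := eqVneq u 0.
  rewrite invr0 chi0 /= !mulr1 addrK.
  rewrite (bigD1 1) //= big1 ?addr0 => [|v v1].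
    by rewrite expr0n mul0r !add0r expr1n eqxx.
  by rewrite expr0n mul0r !add0r sqrf_eq1 (oppr_pchar2 (pchar2 hF)) orbb (negbTE v1).
rewrite mulr0 subr0 -(chi_sqr hF u^-1) -(chiD hF).
have -> : 1 + u^-1 ^+ 2 = (1 + u ^+ 2) / u ^+ 2.
  by rewrite mulrDl divff ?expf_neq0 // mul1r exprVn addrC.
rewrite -(quadratic_count hF _ u0); apply: eq_bigr => v _; congr (nat_of_bool _)%:R.
rewrite -(inj_eq (addIr (u ^+ 2)) (_ + _)); congr (_ == _).
by apply: (eq_mod2 hF (z := u ^+ 2)); ring.
Qed.

Lemma sum_chi_inv : \sum_(x : F) chi x^-1 = 0.
Proof. by rewrite -[RHS](sum_chi hF) [RHS](reindex_inj invr_inj). Qed.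

Lemma kloostermanE : K = \sum_(x : F) chi x * chi x^-1.
Proof. by apply: eq_bigr => x _; rewrite -(chiD hF) addrC. Qed.

(* Four times the number of trace-zero pairs on the conic; the three sums of
   [chi u], [chi v], [chi (u + v)] over it agree by symmetry. *)
Lemma quadric_trace0_count :
  \sum_(u : F) \sum_(v : F) (1 + chi u) * (1 + chi v) * (u ^+ 2 + u * v + v ^+ 2 == 1)%:R =
  (2 ^ n)%:R - chi (1 : F) + 3 * (chi (1 : F) * (K - 1)).
Proof.
pose Q (u v : F) : int := (u ^+ 2 + u * v + v ^+ 2 == 1)%:R.
have QC u v : Q u v = Q v u.
  by rewrite /Q; congr (nat_of_bool (_ == _))%:R; ring.
have QD u v : Q u (u + v) = Q u v.
  rewrite /Q; congr (nat_of_bool (_ == _))%:R.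
  by apply: (eq_mod2 hF (z := u ^+ 2 + u * v)); ring.
have S0 : \sum_(u : F) \sum_(v : F) Q u v = (2 ^ n)%:R - chi (1 : F).
  rewrite (eq_bigr _ (fun u _ => quadric_fiber_count u)) big_split /= big_split /=.
  rewrite -mulr_sumr sum_chi_inv mulr0 addr0 sumr_const hF sumrN; congr (_ - _).
  by under eq_bigr do rewrite mulrC; rewrite sum_indicator.
have S1 : \sum_(u : F) \sum_(v : F) chi u * Q u v = chi (1 : F) * (K - 1).
  under eq_bigr do rewrite -mulr_sumr quadric_fiber_count mulrBr mulrDr mulr1.
  rewrite sumrB big_split /= (sum_chi hF) add0r mulrBr mulr1 kloostermanE mulr_sumr.
  congr (_ - _); first by apply: eq_bigr => u _; ring.
  transitivity (\sum_(u : F) (0 == u)%:R * (chi (1 : F) * chi u)).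
    by apply: eq_bigr => u _; ring.
  by rewrite sum_indicator chi0 mulr1.
have S2 : \sum_(u : F) \sum_(v : F) chi v * Q u v = chi (1 : F) * (K - 1).
  rewrite exchange_big -S1 /=; apply: eq_bigr => u _; apply: eq_bigr => v _.
  by rewrite QC.
have S3 : \sum_(u : F) \sum_(v : F) chi (u + v) * Q u v = chi (1 : F) * (K - 1).
  rewrite -S2; apply: eq_bigr => u _.
  by rewrite [RHS](reindex_inj (addrI u)) /=; apply: eq_bigr => v _; rewrite QD.
pose e := chi (1 : F) * (K - 1).
rewrite (_ : 3 * _ = e + e + e); last by rewrite /e; ring.
rewrite -{1}[e]S1 -{1}[e]S2 -[e]S3 -S0 -!big_split; apply: eq_bigr => u _ /=.
rewrite -!big_split; apply: eq_bigr => v _ /=.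
by rewrite -/(Q u v) (chiD hF); ring.
Qed.

Lemma sum_card_trace0_roots1 :
  2 * \sum_(b : F) (#|trace0_roots b|)%:R = (2 ^ n)%:R :> int.
Proof.
under eq_bigr do rewrite natr_cardset.
rewrite exchange_big mulr_sumr /=.
transitivity (\sum_(u : F) (1 + chi u)); last first.
  by rewrite big_split /= (sum_chi hF) sumr_const hF addr0.
apply: eq_bigr => u _; rewrite -[RHS]mulr1.
rewrite chiE.
rewrite (eq_bigr (fun b => (u ^+ 3 + u + 1 == b)%:R * (abs_trace n u == 0)%:R)).
  by rewrite sum_indicator; case: (_ == 0).
by move=> b _; case: (_ == 0); case: (_ == b).
Qed.

(** The sum of squares counts pairs of trace-zero elements with equal cubic value. The weight [t u]
    is twice the indicator of trace zero, whence the factor 4. *)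
Lemma sum_card_trace0_roots_sqr :
  4 * \sum_(b : F) (#|trace0_roots b|)%:R ^+ 2 =
  3 * (2 ^ n)%:R - 6 * chi (1%R : F) - 2 + 3 * (chi (1%R : F) * K) :> int.
Proof.
pose t (u : F) : int := 1 + chi u.
pose Q (u v : F) : int := (u ^+ 2 + u * v + v ^+ 2 == 1)%:R.
transitivity (\sum_(u : F) \sum_(v : F) t u * t v * (u ^+ 3 + u + 1 == v ^+ 3 + v + 1)%:R).
  rewrite mulr_sumr.
  transitivity (\sum_(b : F) \sum_(u : F) \sum_(v : F)
      (u ^+ 3 + u + 1 == b)%:R * (t u * t v * (v ^+ 3 + v + 1 == b)%:R)).
    apply: eq_bigr => b _; rewrite natr_cardset expr2 big_distrlr /= mulr_sumr.
    apply: eq_bigr => u _; rewrite mulr_sumr; apply: eq_bigr => v _.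
    rewrite /t !chiE.
    by case: (_ == 0); case: (_ == 0); case: (_ == b); case: (_ == b).
  rewrite exchange_big; apply: eq_bigr => u _ /=.
  rewrite exchange_big; apply: eq_bigr => v _ /=.
  by rewrite sum_indicator [in LHS]eq_sym.
(* Inclusion-exclusion on the two alternatives of [cubic_eq]: the diagonal and the conic. *)
transitivity (\sum_(u : F) \sum_v ((u == v)%:R * (t u * t v) + t u * t v * Q u v
              - (u == v)%:R * (t u * t v * Q u v))).
  apply: eq_bigr => u _; apply: eq_bigr => v _; rewrite cubic_eq /Q.
  by case: (u == v); case: (_ == 1); rewrite /= ; ring.
under eq_bigr do rewrite sumrB big_split /= !sum_indicator.
rewrite sumrB big_split /= [X in _ + X - _]quadric_trace0_count.
have -> : \sum_(u : F) t u * t u = 2 * (2 ^ n)%:R.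
  transitivity (\sum_(u : F) (2 + 2 * chi u)).
    by apply: eq_bigr => u _; rewrite /t mulrDl mulrDr mulrDr (chiM hF); ring.
  by rewrite big_split /= -mulr_sumr (sum_chi hF) sumr_const hF addr0 mulr_natr.
(* On the diagonal the conic reads [u ^+ 2 = 1], so it is met at [u = 1] only. *)
have -> : \sum_(u : F) t u * t u * Q u u = 2 + 2 * chi (1 : F).
  transitivity (\sum_(u : F) (1 == u)%:R * (t u * t u)).
    apply: eq_bigr => u _; rewrite mulrC; congr ((nat_of_bool _)%:R * _).
    rewrite (_ : _ + _ = u ^+ 2); last by apply: (eq_mod2 hF (z := u ^+ 2)); ring.
    by rewrite sqrf_eq1 (oppr_pchar2 (pchar2 hF)) orbb eq_sym.
  by rewrite sum_indicator /t mulrDl mulrDr mulrDr (chiM hF); ring.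
by ring.
Qed.

Lemma omega_pow7_system :
  [/\ (omega F 7 0)%:R + (omega F 7 2)%:R + (omega F 7 4)%:R + (omega F 7 6)%:R
        = (2 ^ n)%:R :> int,
      2 * ((omega F 7 2)%:R + 2 * (omega F 7 4)%:R + 3 * (omega F 7 6)%:R)
        = (2 ^ n)%:R :> int
    & 4 * ((omega F 7 2)%:R + 4 * (omega F 7 4)%:R + 9 * (omega F 7 6)%:R)
        = 3 * (2 ^ n)%:R - 6 * (-1) ^+ odd n - 2 + 3 * ((-1) ^+ odd n * K) :> int].
Proof.
split.
- have := sum_card_trace0_roots (fun=> 1); rewrite sumr_const hF !mul1r => <-.
  by [].
- have := sum_card_trace0_roots (fun k => k%:R); rewrite -sum_card_trace0_roots1 => ->.
  by ring.
- have := sum_card_trace0_roots (fun k => k%:R ^+ 2).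
  rewrite -(chi1 hF) -sum_card_trace0_roots_sqr => ->; by ring.
Qed.

End CubicRoots.

(** With [q = 128 * m], this refutes [3 * K = q + 4] against [kloosterman1_bound] multiplied by 81.
    After the shift to [k] the difference of the two sides has positive coefficients only, so [lra]
    can treat the powers of [k] as atoms. *)
Lemma cubic_lt_quartic_odd (m : int) : 1 <= m ->
  ((128 * m + 4) ^+ 2 - 9 * (128 * m)) ^+ 2 <=
    81 * ((128 * m) ^+ 3 + 7 * (128 * m) ^+ 2) -> False.
Proof.
rewrite -subr_ge0; set k := m - 1; have -> : m = k + 1 by rewrite subrK.
move=> k0; have [k2 k3 k4] : [/\ 0 <= k ^+ 2, 0 <= k ^+ 3 & 0 <= k ^+ 4].
  by rewrite !exprn_ge0.
lra.
Qed.

(** The same for [3 * K = 16 - q]; at [m = 1] there would be no contradiction. *)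
Lemma cubic_lt_quartic_even (m : int) : 2 <= m ->
  ((16 - 128 * m) ^+ 2 - 9 * (128 * m)) ^+ 2 <=
    81 * ((128 * m) ^+ 3 + 7 * (128 * m) ^+ 2) -> False.
Proof.
rewrite -subr_ge0; set k := m - 2; have -> : m = k + 2 by rewrite subrK.
move=> k0; have [k2 k3 k4] : [/\ 0 <= k ^+ 2, 0 <= k ^+ 3 & 0 <= k ^+ 4].
  by rewrite !exprn_ge0.
lra.
Qed.

(** * The fourth moment of Kloosterman sums, and the value 6 of the uniformity *)

Section KloostermanBound.

Variables (n : nat) (F : finFieldType).
Hypothesis hF : #|F| = (2 ^ n)%N.

Local Notation chi := (trace_char n).
Local Notation K := (kloosterman1 F n).
Local Notation q := ((2 ^ n)%:R : int).

Definition fourier (f : F -> int) (a : F) : int := \sum_s chi (a * s) * f s.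

(** Orthogonality of characters; [chi] is real, so no conjugate appears. *)
Lemma parseval (f g : F -> int) :
  \sum_a fourier f a * fourier g a = q * \sum_s f s * g s.
Proof.
transitivity (\sum_(a : F) \sum_(s : F) \sum_(t : F) f s * g t * chi ((s + t) * a)).
  apply: eq_bigr => a _; rewrite /fourier big_distrlr /=.
  apply: eq_bigr => s _; apply: eq_bigr => t _.
  by rewrite mulrDl (chiD hF) ![_ * a]mulrC; ring.
rewrite exchange_big mulr_sumr; apply: eq_bigr => s _ /=.
rewrite exchange_big /=.
transitivity (\sum_(t : F) (s == t)%:R * (q * (f s * g t))).
  apply: eq_bigr => t _; rewrite -mulr_sumr (sum_chiM hF) (addr_eq0_pchar2 hF).
  by rewrite natrM; ring.
by rewrite sum_indicator.
Qed.

Definition kloosterman (a : F) : int := fourier (fun s => chi s^-1) a.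

Definition autocorrelation (s : F) : int := \sum_(x : F) chi (x^-1 + (x + s)^-1).

Lemma kloosterman_eq0 : kloosterman 0 = 0.
Proof.
rewrite -[RHS](sum_chi_inv hF); apply: eq_bigr => s _.
by rewrite mul0r chi0 mul1r.
Qed.

Lemma kloosterman_eq1 : kloosterman 1 = K.
Proof. by rewrite (kloostermanE hF); apply: eq_bigr => s _; rewrite mul1r. Qed.

(** Write the second variable of the double sum as [x + s]; the two factors [chi (a * x)] cancel. *)
Lemma kloosterman_sqr (a : F) : kloosterman a ^+ 2 = fourier autocorrelation a.
Proof.
rewrite expr2 [LHS]big_distrlr /=.
transitivity (\sum_(x : F) \sum_(s : F) chi (a * s) * chi (x^-1 + (x + s)^-1)).
  apply: eq_bigr => x _; rewrite (reindex_inj (addrI x)) /=; apply: eq_bigr => s _.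
  rewrite mulrDr !(chiD hF) -[RHS]mul1r -(chiM hF (a * x)); ring.
by rewrite exchange_big; apply: eq_bigr => s _; rewrite mulr_sumr.
Qed.

Lemma autocorrelation0 : autocorrelation 0 = q.
Proof.
rewrite /autocorrelation (eq_bigr (fun=> 1)) => [|x _].
  by rewrite sumr_const hF.
by rewrite addr0 (addrr_pchar2 (pchar2 hF)) chi0.
Qed.

(** Each value [u] of [t ^+ 2 + t] has weight [1 + chi u]. The constant part sums to zero, and
    [u = c * w] turns the rest into a Kloosterman sum. *)
Lemma sum_chi_inv_artin_schreier (c : F) : c != 0 ->
  \sum_(t : F) chi (c * (t ^+ 2 + t)^-1) = kloosterman c.
Proof.
move=> c0.
transitivity (\sum_(t : F) \sum_(u : F) (t ^+ 2 + t == u)%:R * chi (c * u^-1)).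
  by apply: eq_bigr => t _; rewrite sum_indicator.
rewrite exchange_big /=.
under eq_bigr do rewrite -mulr_suml (artin_schreier_count hF) mulrDl mul1r.
rewrite big_split /= [X in X + _](_ : _ = 0) ?add0r.
  rewrite (reindex_inj (mulfI c0)); apply: eq_bigr => w _ /=.
  by rewrite invfM mulVKf.
transitivity (\sum_(u : F) chi (c * u)); first by rewrite [RHS](reindex_inj invr_inj).
by rewrite (sum_chiM hF) (negbTE c0) muln0.
Qed.

(** Put [x = s * t] and use [1/t + 1/(t + 1) = 1/(t ^ 2 + t)]. This fails at [t = 0] and [t = 1],
    where [0^-1 = 0]; each contributes a correction [chi s^-1 - 1]. *)
Lemma autocorrelation_neq0 (s : F) : s != 0 ->
  autocorrelation s = kloosterman s^-1 + 2 * chi s^-1 - 2.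
Proof.
move=> s0; have c0 : s^-1 != 0 by rewrite invr_eq0.
rewrite /autocorrelation (reindex_inj (mulfI s0)) /=.
transitivity (\sum_(t : F) (chi (s^-1 * (t ^+ 2 + t)^-1)
   + (0 == t)%:R * (chi s^-1 - 1) + (1 == t)%:R * (chi s^-1 - 1))); last first.
  rewrite !big_split /= !sum_indicator (sum_chi_inv_artin_schreier c0); ring.
apply: eq_bigr => t _.
have [<-|t0] := eqVneq 0 t.
  by rewrite oner_eq0 expr0n /= addr0 invr0 !mulr0 invr0 chi0 !add0r; ring.
have [<-|t1] := eqVneq 1 t.
  by rewrite mulr1 expr1n !(addrr_pchar2 (pchar2 hF)) invr0 mulr0 chi0 addr0 /=; ring.
rewrite !mul0r !addr0; congr (trace_char n _).
rewrite (_ : s * t + s = s * (t + 1)); last by ring.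
rewrite !invfM -mulrDr; congr (_ * _).
have t1' : t + 1 != 0 by rewrite (addr_eq0_pchar2 hF) eq_sym.
have t0' : t != 0 by rewrite eq_sym.
apply: (mulIf (mulf_neq0 t0' t1')).
rewrite (_ : t ^+ 2 + t = t * (t + 1)) ?mulVf ?mulf_neq0 //; last by ring.
rewrite mulrDl mulKf // mulrA mulrAC mulVf // mul1r.
by apply: (eq_mod2 hF (z := t)); ring.
Qed.

Lemma sum_autocorrelation_sqr :
  \sum_s autocorrelation s * autocorrelation s = 2 * q ^+ 2 + 4 * q * (1 + chi (1 : F)).
Proof.
(* Chosen so that [fourier d s^-1] is [autocorrelation s] for [s != 0]; at [s = 0] the former is 0
   and the latter [q]. *)
pose d (s : F) : int := chi s^-1 + (1 == s)%:R * 2 - (0 == s)%:R * 2.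
have dE c : fourier d c = kloosterman c + 2 * chi c - 2.
  transitivity (\sum_s (chi (c * s) * chi s^-1 + (1 == s)%:R * (2 * chi (c * s))
     - (0 == s)%:R * (2 * chi (c * s)))).
    by apply: eq_bigr => s _; rewrite /d; ring.
  by rewrite sumrB big_split /= !sum_indicator mulr1 mulr0 chi0 mulr1.
transitivity (\sum_s (fourier d s^-1 * fourier d s^-1 + (0 == s)%:R * q ^+ 2)).
  apply: eq_bigr => s _; have [<-|s0] := eqVneq 0 s.
    by rewrite autocorrelation0 dE invr0 kloosterman_eq0 chi0 /=; ring.
  by rewrite autocorrelation_neq0 1?eq_sym // dE /=; ring.
rewrite big_split /= sum_indicator.
transitivity (\sum_s fourier d s * fourier d s + q ^+ 2).
  by congr (_ + _); rewrite [RHS](reindex_inj invr_inj).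
rewrite parseval.
(* [d] takes the values 1 and -1 except at 1, where its square is [5 + 4 * chi 1]. *)
transitivity (q * (\sum_(s : F) (1 + (1 == s)%:R * (4 + 4 * chi s))) + q ^+ 2).
  congr (q * _ + _); apply: eq_bigr => s _; rewrite /d.
  have [<-|s0] := eqVneq 0 s.
    by rewrite oner_eq0 invr0 chi0 /=; ring.
  have [<-|s1] := eqVneq 1 s.
    have := chiM hF 1; rewrite invr1 => e.
    rewrite !mul1r mul0r subr0 mulrDl mulrDr mulrDr e /=; ring.
  by rewrite !mul0r addr0 subr0 (chiM hF) addr0.
by rewrite big_split /= sum_indicator sumr_const hF; ring.
Qed.

Lemma kloosterman1_bound : (K ^+ 2 - q) ^+ 2 <= q ^+ 3 + 7 * q ^+ 2.
Proof.
have S : \sum_a (kloosterman a ^+ 2 - q) ^+ 2 = q ^+ 3 + 4 * q ^+ 2 * (1 + chi (1 : F)).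
  transitivity (\sum_a (fourier autocorrelation a * fourier autocorrelation a
      - (2 * q) * (kloosterman a * kloosterman a) + q ^+ 2)).
    by apply: eq_bigr => a _; rewrite -!kloosterman_sqr; ring.
  rewrite big_split sumrB /= -mulr_sumr !parseval sum_autocorrelation_sqr.
  under [\sum_s chi s^-1 * _]eq_bigr do rewrite (chiM hF).
  by rewrite !sumr_const hF -[_ *+ _]mulr_natr; ring.
have le1 : chi (1 : F) <= 1 by rewrite /trace_char; case: (_ != 0).
(* Only the terms [a = 0], equal to [q ^+ 2], and [a = 1] are kept. *)
have : q ^+ 2 + (K ^+ 2 - q) ^+ 2 <= \sum_a (kloosterman a ^+ 2 - q) ^+ 2.
  rewrite (bigD1 0) //= (bigD1 1) ?oner_eq0 //= kloosterman_eq0 kloosterman_eq1 addrA.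
  rewrite expr0n sub0r sqrrN lerDl; apply: sumr_ge0 => a _; exact: sqr_ge0.
have q2 : 0 <= q ^+ 2 by exact: sqr_ge0.
rewrite S; nia.
Qed.

(** If [omega F 7 6] were 0, the moments would make [3 * K] equal to [q + 4] or [16 - q], whereas
    the bound on [K] is of order [q] to the power 3/4. *)
Lemma omega6_neq0_ge7 : (7 <= n)%N -> omega F 7 6 != 0%N.
Proof.
move=> n7; apply/eqP => w6.
have [_] := omega_pow7_system hF; rewrite w6 (omega4 hF) => E2 E3.
have B := kloosterman1_bound.
have : q = 128 * (2 ^ (n - 7))%:R by rewrite -natrM -(expnD 2 7) subnKC.
move: E2 E3 B; set x := kloosterman1 F n; set m := (2 ^ (n - 7))%:R : int.
set w2 := (omega F 7 2)%:R : int => E2 E3 B qE.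
have m1 : 1 <= m by rewrite ler1n expn_gt0.
rewrite qE in E2 E3 B.
have [on|en] := boolP (odd n); rewrite ?on ?(negbTE en) /= in E2 E3.
  have x3 : 3 * x = 128 * m + 4 by lia.
  apply: (cubic_lt_quartic_odd m1); rewrite -x3.
  rewrite (_ : (_ - _) ^+ 2 = 81 * (x ^+ 2 - 128 * m) ^+ 2); last by ring.
  by rewrite ler_pM2l.
have m2 : 2 <= m.
  rewrite /m (ler_nat _ 2) -{1}(expn1 2) leq_exp2l // subn_gt0 ltn_neqAle n7 andbT.
  by apply: contraNneq en => <-.
have x3 : 3 * x = 16 - 128 * m by lia.
apply: (cubic_lt_quartic_even m2); rewrite -x3.
rewrite (_ : (_ - _) ^+ 2 = 81 * (x ^+ 2 - 128 * m) ^+ 2); last by ring.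
by rewrite ler_pM2l.
Qed.

(** [X^10 - X] cannot vanish at all 64 elements, so some ninth power [t] is a nontrivial seventh
    root of unity. Over the prime field [X^7 - 1] is [X + 1] times two cubics, exchanged by
    [X |-> X + 1]. *)
Lemma cubic_root_F64 : n = 6 -> exists r : F, r ^+ 3 + r + 1 = 0.
Proof.
move=> n6.
have [/existsP[g gn]|/existsPn h] := boolP [exists g : F, g ^+ 10 != g].
  have g0 : g != 0 by apply: contraNneq gn => ->; rewrite expr0n.
  pose t := g ^+ 9.
  have t1 : t != 1.
    by apply: contraNneq gn => e; rewrite exprS -/t e mulr1.
  have t7 : t ^+ 7 = 1.
    apply: (mulfI g0); rewrite -exprM -exprS mulr1.
    by have := expf_card g; rewrite hF n6.
  have : (t + 1) * ((t ^+ 3 + t + 1) * ((t + 1) ^+ 3 + (t + 1) + 1)) = 0.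
    rewrite -(addrr_pchar2 (pchar2 hF) 1) -[X in _ = X + _]t7.
    pose z := t ^+ 6 + t ^+ 5 + 2 * t ^+ 4 + 2 * t ^+ 3 + t ^+ 2 + t
      + (t + 1) * (t ^+ 3 + t + 1) * (t ^+ 2 + 2 * t + 1).
    by apply: (eq_mod2 hF (z := z)); rewrite /z; ring.
  move/eqP; rewrite !mulf_eq0 (addr_eq0_pchar2 hF) (negbTE t1) /=.
  by case/orP => /eqP e; [exists t|exists (t + 1)].
have p0 : ('X^10 - 'X : {poly F}) != 0.
  by rewrite -size_poly_eq0 size_polyDl size_polyXn ?size_polyN ?size_polyX.
have := max_poly_roots p0 (rs := enum F).
rewrite enum_uniq -cardE hF n6 size_polyDl size_polyXn ?size_polyN ?size_polyX //.
move=> /(_ _ isT) H; suff : false by []. apply: H; apply/allP => c _.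
by rewrite rootE !hornerE subr_eq0; move: (h c); rewrite negbK.
Qed.

(** For [b = 0], [r] and [r ^+ 2] are distinct trace-zero roots; exactly two are possible only for
    [b = 1], so there are three. *)
Lemma omega6_neq0_eq6 : n = 6 -> omega F 7 6 != 0%N.
Proof.
move=> n6; have [r r3] := cubic_root_F64 n6.
have r8 : r ^+ 8 = r.
  transitivity ((r ^+ 3 + r + 1) * (r * (r + 1) * (r ^+ 3 + r ^+ 2 + 1)) + r).
    pose z := - r - r * (r ^+ 6 + r ^+ 5 + 2 * r ^+ 4 + 2 * r ^+ 3 + r ^+ 2 + r).
    by apply: (eq_mod2 hF (z := z)); rewrite /z; ring.
  by rewrite r3 mul0r add0r.
have tr : abs_trace n r = 0.
  rewrite /abs_trace n6 !big_ord_recl big_ord0 /= /bump /=.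
  (* By [r ^+ 8 = r] the six conjugates are [r], [r ^+ 2], [r ^+ 4], each occurring twice. *)
  rewrite (exprM r 8 2) (exprM r 8 4) r8.
  by apply: (eq_mod2 hF (z := r + r ^+ 2 + r ^+ 4)); ring.
have rr : r \in trace0_roots n 0 by rewrite inE tr r3 !eqxx.
have rr2 : r ^+ 2 \in trace0_roots n 0.
  rewrite inE (abs_trace_sqr hF) tr eqxx /=.
  have -> : (r ^+ 2) ^+ 3 + r ^+ 2 + 1 = (r ^+ 3 + r + 1) ^+ 2.
    by apply: (eq_mod2 hF (z := - r - r ^+ 3 - r ^+ 4)); ring.
  by rewrite r3 expr0n.
have ne : r != r ^+ 2.
  apply/eqP => e; move/eqP: r3; rewrite exprS -e -expr2 -e.
  by rewrite (addrr_pchar2 (pchar2 hF)) add0r oner_eq0.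
rewrite -lt0n (omega_pow7 hF 3) card_gt0; apply/set0Pn; exists 0%R; rewrite inE.
have c1 : (1 < #|trace0_roots n (0%R : F)|)%N by apply/card_gt1P; exists r, (r ^+ 2).
have := card_trace0_roots_eq2 hF 0%R; rewrite (eq_sym 0%R) oner_eq0 /=.
by move: (card_trace0_roots_le3 hF 0%R) c1; case: #|_| => [|[|[|[|k]]]].
Qed.

Lemma differential_uniformity_pow7 : (6 <= n)%N -> differential_uniformity F 7 = 6%N.
Proof.
move=> n6; apply/eqP; rewrite eqn_leq; apply/andP; split.
  apply/bigmax_leqP => b _; rewrite (delta_pow7 hF).
  by rewrite (leq_mul2l 2 _ 3) card_trace0_roots_le3.
have : omega F 7 6 != 0%N.
  move: n6; rewrite leq_eqVlt => /orP[/eqP e|]; last exact: omega6_neq0_ge7.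
  by apply: omega6_neq0_eq6.
rewrite -lt0n card_gt0 => /set0Pn[b]; rewrite inE => /eqP e.
by rewrite -[X in (X <= _)%N]e; exact: leq_bigmax.
Qed.

End KloostermanBound.

Theorem theorem5 (n : nat) (F : finFieldType)
    (hn : (4 <= n)%N) (hF : #|F| = (2 ^ n)%N) :
  let w (i : nat) : rat := (omega F 7 i)%:R in
  let K1 : rat := (kloosterman1 F n)%:~R in
  [/\ forall i : nat, i \notin [:: 0; 2; 4; 6]%N -> w i = 0,
      odd n ->
      [/\ w 6%N = (2 ^+ (n - 2) + 1) / 6 - K1 / 8,
          w 4%N = 0,
          w 2%N = 2 ^+ (n - 1) - 3 * w 6%N
        & w 0%N = 2 ^+ (n - 1) + 2 * w 6%N],
      ~~ odd n ->
      [/\ w 6%N = (2 ^+ (n - 2) - 4) / 6 + K1 / 8,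
          w 4%N = 1,
          w 2%N = 2 ^+ (n - 1) - 3 * w 6%N - 2
        & w 0%N = 2 ^+ (n - 1) + 2 * w 6%N + 1]
    & (6 <= n)%N -> differential_uniformity F 7 = 6%N].
Proof.
move=> w K1.
have w4 : w 4%N = (~~ odd n)%:R by rewrite /w (omega4 hF).
(* Over the rationals, with [2 ^+ (n - 2)] as an atom and [omega F 7 4] known, the moment system is
   linear and [lra] solves it. *)
have castK (x y : int) : x = y -> x%:~R = y%:~R :> rat by move=> ->.
have [/castK E1 /castK E2 /castK E3] := omega_pow7_system hF.
have q2 : (2 ^ n)%:R = 4 * 2 ^+ (n - 2) :> rat.
  by rewrite -(natrX _ 2) -natrM -(expnD 2 2) subnKC // ltnW // ltnW.
have q1 : 2 ^+ (n - 1) = 2 * 2 ^+ (n - 2) :> rat.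
  by rewrite -exprS -subSn // ltnW // ltnW.
rewrite q1; move: w4 q2 E1 E2 E3; set a := 2 ^+ (n - 2).
rewrite !(rmorphD, rmorphB, rmorphN, rmorphM, rmorphXn, rmorph_nat, rmorph1) /=.
rewrite -![(omega F 7 _)%:R]/(w _) -/K1.
move=> w4 q2 E1 E2 E3; split.
- by move=> i hi; rewrite /w (omega_pow7_eq0 hF).
- by move=> on; rewrite on q2 /= in w4 E1 E2 E3; split; lra.
- by move=> en; rewrite (negbTE en) q2 /= in w4 E1 E2 E3; split; lra.
- exact: differential_uniformity_pow7.
Qed.
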